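(* $\mathfrak{s}=\mathfrak{s}(2)=\mathfrak{s}(\mathcal{NC})$.
   Context: For $A\subseteq\omega\times\omega$ and $n<\omega$ let $A(n)=\{m<\omega:(n,m)\in A\}$. A family $\mathcal{X}\subseteq[\omega]^\omega$ is centered if $\bigcap F$ is infinite for every finite nonempty $F\subseteq\mathcal{X}$. The Nowhere Centered ideal on $\omega\times\omega$ is $\mathcal{NC}=\{A\subseteq\omega\times\omega:\ \text{for every } X\in[\omega]^\omega \text{ the family } \{A(n):n\in X\}\text{ is not centered}\}$; it is an ideal, and $\mathcal{NC}^+=\mathcal{P}(\omega\times\omega)\setminus\mathcal{NC}$. For $A,B\in\mathcal{NC}^+$, $A$ splits $B$ if $A\cap B\in\mathcal{NC}^+$ and $B\setminus A\in\mathcal{NC}^+$; $\mathfrak{s}(\mathcal{NC})$ is the least size of $\mathcal{S}\subseteq\mathcal{NC}^+$ such that every $X\in\mathcal{NC}^+$ is split by some $Y\in\mathcal{S}$. $\mathfrak{s}$ is the usual splitting number (the same notion for the ideal of finite subsets of $\omega$). $\mathfrak{s}(2)$ is the splitting number of the Boolean algebra $\mathcal{P}(\omega)/\mathrm{fin}\oplus\mathcal{P}(\omega)/\mathrm{fin}$ (free product; equivalently the algebra of clopen subsets of $(\beta\omega\setminus\omega)^2$), i.e. the least size of a set $S$ of nonzero elements such that for every nonzero $b$ there is $s\in S$ with $b\wedge s\neq 0$ and $b\wedge -s\neq 0$. *)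

(* Defs.v *)
From HB Require Import structures.
From mathcomp Require Import all_boot all_order.
From mathcomp Require Import all_classical topology.

Set Implicit Arguments.
Unset Strict Implicit.
Unset Printing Implicit Defensive.

Local Open Scope classical_set_scope.
Local Open Scope card_scope.

(* [K] has the cardinality min {|S| : F S}.  Cardinals are represented by sets
   up to equipotence, so such a [K] is determined up to [#=]; that the minimum
   is attained is part of the assertion. *)
Definition least_size (T U : Type) (F : set (set T)) (K : set U) : Prop :=
  (exists2 S, F S & S #= K) /\ (forall S, F S -> K #<= S).

Definition splits (T : Type) (J : set (set T)) (A B : set T) : Prop :=
  ~ J (A `&` B) /\ ~ J (B `\` A).

Definition splitting_family (T : Type) (J : set (set T)) : set (set (set T)) :=
  [set S | S `<=` ~` J /\
    forall X, ~ J X -> exists2 Y, S Y & splits J Y X].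

Definition Fin : set (set nat) := [set A | finite_set A].

Definition centered (X : set (set nat)) : Prop :=
  X `<=` [set A | infinite_set A] /\
  forall F : set (set nat), finite_set F -> F !=set0 -> F `<=` X ->
    infinite_set (\bigcap_(A in F) A).

Definition NC : set (set (nat * nat)) :=
  [set A | forall X : set nat, infinite_set X ->
    ~ centered [set xsection A n | n in X]].

(* [B] is a field of sets: its zero is [set0] and its complement is [~`]. *)
Definition algebra_splitting_family (T : Type) (B : set (set T)) :
    set (set (set T)) :=
  [set S | S `<=` [set s | B s /\ s !=set0] /\
    forall b, B b -> b !=set0 ->
      exists s, [/\ S s, b `&` s !=set0 & b `&` ~` s !=set0]].

Definition omega_star : Type :=
  {U : set_system nat | UltraFilter U /\ forall n, ~ U [set n]}.

HB.instance Definition _ := gen_eqMixin omega_star.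
HB.instance Definition _ := gen_choiceMixin omega_star.

Definition star (A : set nat) : set omega_star := [set U | sval U A].

Lemma starT : star setT = setT.
Proof.
apply/seteqP; split=> // -[U [UU nU]] _.
by rewrite /star /=; exact: filterT.
Qed.

Lemma starI (A B : set nat) : star (A `&` B) = star A `&` star B.
Proof.
apply/seteqP; split=> -[U [UU nU]]; rewrite /star /=.
  by move=> UAB; split; apply: filterS UAB => x [].
by case; exact: filterI.
Qed.

Lemma starC (A : set nat) : star (~` A) = ~` star A.
Proof.
apply/seteqP; split=> -[U [UU nU]]; rewrite /star /=.
  move=> UC UA; apply: (@filter_not_empty _ U _).
  by rewrite -(setICr A); exact: filterI.
by move=> nUA; have [] := in_ultra_setVsetC A UU.
Qed.

Lemma star_cover : \bigcup_(A in [set: set nat]) star A = setT.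
Proof. by apply/seteqP; split=> // U _; exists setT => //; rewrite starT. Qed.

Lemma star_join (A B : set nat) (U : omega_star) :
  setT A -> setT B -> star A U -> star B U ->
  exists C, [/\ setT C, star C U & star C `<=` star A `&` star B].
Proof. by move=> _ _ AU BU; exists (A `&` B); rewrite starI; split. Qed.

HB.instance Definition _ :=
  isBaseTopological.Build omega_star star_cover star_join.

(* The free product of P(omega)/fin with itself: the clopen algebra of the
   square of its Stone space [omega_star].  The lemmas below check the
   characteristic properties of a free product for the two maps sending the
   class of [A] to [star A `*` setT] and to [setT `*` star A]. *)
Definition free_square : set (set (omega_star * omega_star)) :=
  [set C | clopen C].

Lemma star_open (A : set nat) : open (star A).
Proof. by exists [set A] => //; rewrite bigcup_set1. Qed.

Lemma star_clopen (A : set nat) : clopen (star A).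
Proof.
split; first exact: star_open.
by rewrite -[star A]setCK -starC; apply: open_closedC; exact: star_open.
Qed.

(* The kernel is the ideal of finite sets. *)
Lemma star_eq0 (A : set nat) : star A = set0 <-> finite_set A.
Proof.
split=> [A0|finA]; last first.
  apply/seteqP; split=> // -[U [UU nU]]; rewrite /star /= => UA.
  have H : forall B : set nat, finite_set B -> ~ U B.
    move=> _ /finite_seqP[s ->]; elim: s => [|a s IHs].
      by rewrite set_nil; exact: (@filter_not_empty _ U _).
    move=> Us; apply: IHs.
    have [/nU//|Ua] := in_ultra_setVsetC [set a] UU.
    apply: filterS (filterI Ua Us) => x [/= xa].
    by rewrite inE => /orP[/eqP|].
  exact: H UA.
apply: contrapT => infA.
pose F : set_system nat := [set B | finite_set (A `\` B)].
have FF : ProperFilter F.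
  apply: Build_ProperFilter; first by rewrite /F /= setD0.
  split; first by rewrite /F /= setDT; exact: finite_set0.
    by move=> B C FB FC; rewrite /F /= setDIr finite_setU.
  move=> B C BC; apply: sub_finite_set; exact: setDS.
have [U [UU FU]] := ultraFilterLemma FF.
have nU : forall n, ~ U [set n].
  move=> n Un; have /FU Un' : F (~` [set n]).
    by rewrite /F /= setDE setCK; apply: finite_setIr; exact: finite_set1.
  apply: (@filter_not_empty _ U _).
  by rewrite -(setICr [set n]); exact: filterI.
have : star A (exist _ U (conj UU nU)).
  by apply: FU; rewrite /F /= setDv; exact: finite_set0.
by rewrite A0.
Qed.

(* Independence of the two factors. *)
Lemma rectangle_eq0 (A B : set nat) :
  star A `*` star B = set0 <-> finite_set A \/ finite_set B.
Proof.
split=> [AB0|].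
  apply: contrapT => /not_orP[/star_eq0/eqP/set0P[u Au]].
  move=> /star_eq0/eqP/set0P[v Bv].
  by have : (star A `*` star B) (u, v) by []; rewrite AB0.
by case=> /star_eq0 ->; rewrite ?set0X ?setX0.
Qed.

Lemma omega_star_compact : compact [set: omega_star].
Proof.
rewrite compact_ultra => F FF _.
pose U : set_system nat := [set A | F (star A)].
have UC A : U A \/ U (~` A).
  by rewrite /U /= starC; exact: in_ultra_setVsetC.
have PU : ProperFilter U.
  apply: Build_ProperFilter.
    rewrite /U /=; have /star_eq0 -> := finite_set0 nat.
    exact: (@filter_not_empty _ F _).
  split; first by rewrite /U /= starT; exact: filterT.
    by move=> A B UA UB; rewrite /U /= starI; exact: filterI.
  move=> A B AB; rewrite /U /= => FA; apply: filterS FA => -[V [VV nV]].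
  by rewrite /star /= => VA; apply: filterS VA.
have UU : UltraFilter U.
  split=> // G PG UG; apply/seteqP; split=> // A GA.
  have [//|/UG GCA] := UC A.
  exfalso; apply: (@filter_not_empty _ G _).
  by rewrite -(setICr A); exact: filterI.
have nU n : ~ U [set n].
  by rewrite /U /=; have /star_eq0 -> := finite_set1 n; exact: (@filter_not_empty _ F _).
exists (exist _ U (conj UU nU)); split => // W.
rewrite nbhsE => -[O [[D _ <-] [A DA UA]] OW].
have FA : F (star A) by exact: UA.
by apply: filterS FA => V AV; apply: OW; exists A.
Qed.

(* The images of the two maps generate the algebra. *)
Lemma free_square_rectangles (C : set (omega_star * omega_star)) :
  free_square C <->
  exists s : seq (set nat * set nat),
    C = \bigcup_(p in [set` s]) (star p.1 `*` star p.2).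
Proof.
pose R (s : seq (set nat * set nat)) : set (omega_star * omega_star) :=
  \bigcup_(p in [set` s]) (star p.1 `*` star p.2).
split=> [[oC cC]|[s ->]]; last first.
  rewrite bigcup_seq; elim/big_ind: _ => //.
  - by split; [exact: open0|exact: closed0].
  - by move=> A B [oA cA] [oB cB]; split; [exact: openU|exact: closedU].
  - move=> -[A B] _ /=; have [oA cA] := star_clopen A.
    have [oB cB] := star_clopen B.
    have -> : star A `*` star B = fst @^-1` star A `&` snd @^-1` star B by [].
    split; [apply: openI|apply: closedI].
    + by apply: open_comp => // x _; exact: cvg_fst.
    + by apply: open_comp => // x _; exact: cvg_snd.
    + by apply: preimage_closed => // x _; exact: cvg_fst.
    + by apply: preimage_closed => // x _; exact: cvg_snd.
apply: contrapT => nC.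
have RU s t : R (s ++ t) = R s `|` R t.
  rewrite /R -bigcup_setU; congr bigcup.
  by apply/seteqP; split=> p /=; rewrite mem_cat => /orP.
pose F := filter_from [set s | R s `<=` C] (fun s => C `\` R s).
have FF : ProperFilter F.
  apply: filter_from_proper; last first.
    move=> s RsC; apply/set0P/eqP; rewrite setD_eq0 => CRs.
    by apply: nC; exists s; apply/seteqP; split.
  apply: filter_from_filter.
    by exists [::] => x /=; rewrite /R set_nil bigcup_set0.
  move=> s t RsC RtC; exists (s ++ t) => /=; first by rewrite RU subUset.
  by rewrite RU setDUr.
have cptC : compact C.
  apply: (subclosed_compact cC) (@subsetT _ C).
  rewrite -setXTT; apply: compact_setX; exact: omega_star_compact.
have [|[u v] [Cuv clF]] := cptC F FF.
  by exists [::] => [x|x []//]; rewrite /R /= set_nil bigcup_set0.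
have [[P Q] /= [Pu Qv] PQC] : nbhs (u, v) C by apply: open_nbhs_nbhs.
move: Pu; rewrite nbhsE => -[_ [[D _ <-] [A DA Au]] DP].
move: Qv; rewrite nbhsE => -[_ [[E _ <-] [B EB Bv]] EQ].
have RE : R [:: (A, B)] = star A `*` star B.
  by rewrite /R set_cons1 bigcup_set1.
have RC : R [:: (A, B)] `<=` C.
  rewrite RE => -[a b] [/= Aa Bb]; apply: PQC; split=> /=.
    by apply: DP; exists A.
  by apply: EQ; exists B.
have [] := clF (C `\` R [:: (A, B)]) (star A `*` star B).
- by exists [:: (A, B)].
- exists (star A, star B) => //=; split; apply: open_nbhs_nbhs; split => //;
    exact: star_open.
- by move=> w [[_ +]]; rewrite RE.
Qed.

(* Main.v *)
Require Import Defs.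
From mathcomp Require Import all_boot all_order.
From mathcomp Require Import all_classical topology.

(** Upper bounds: if Y splits X in the usual sense, then the cylinder over Y
    splits every rectangle with base X in the free product and every positive
    set whose centered family of sections is indexed by X.
    Lower bounds: an element of the free product is a finite union of
    rectangles, and if it splits [star X `*` star X] then a side of one of these
    rectangles splits X.  If no section A(n) of a member A of an NC-splitting
    family S splits Y, then A splits X x Y in the sense of NC only if the set of
    those n for which Y is almost contained in A(n) splits X; so either the
    sections or these sets form a splitting family.
    Each time the new family has size at most |S| * omega, and this is absorbed
    because the splitting number is uncountable. *)

Set Implicit Arguments.
Unset Strict Implicit.
Unset Printing Implicit Defensive.

Local Open Scope classical_set_scope.
Local Open Scope card_scope.

(** * Cardinal arithmetic: minima and products with omega *)

Lemma sub_image_card_le (T U : Type) (f : T -> U) (A : set U) (B : set T) :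
  A `<=` f @` B -> A #<= B.
Proof. by move=> /subset_card_le AB; apply: card_le_trans AB (card_image_le _ _). Qed.

Lemma inj_sub_card_le (T U : Type) (f : T -> U) (A : set T) (B : set U) :
  (forall x y, A x -> A y -> f x = f y -> x = y) ->
  (forall x, A x -> B (f x)) -> A #<= B.
Proof.
move=> fI fAB.
have fE : f @` A #= A.
  by apply: inj_card_eq => x y /set_mem Ax /set_mem Ay; exact: fI.
rewrite -(card_le_eql fE); apply: subset_card_le => _ [x Ax <-]; exact: fAB.
Qed.

(* Zorn's lemma gives a maximal set M of choice functions on F whose evaluation
   maps at members of F are all injective; by maximality one of them is onto. *)
Lemma exists_card_min (T : Type) (F : set (set T)) : F !=set0 ->
  exists2 K, F K & forall S, F S -> K #<= S.
Proof.
move=> [S0 FS0].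
pose P (M : set (set T -> T)) :=
  (forall f S, M f -> F S -> S (f S)) /\
  (forall f g S, M f -> M g -> F S -> f S = g S -> f = g).
have [C CP totC|M [[MS Minj] Mmax]] := @Zorn_bigcup _ P.
  split=> [f S [M CM Mf]|f g S [M CM Mf] [N CN Ng]].
    by have [+ _] := CP _ CM; apply.
  have [MN|NM] := totC _ _ CM CN.
    by have [_ +] := CP _ CN; apply=> //; exact: MN.
  by have [_ +] := CP _ CM; apply=> //; exact: NM.
have [[K FK KM]|nK] :=
    pselect (exists2 K, F K & K `<=` [set f K | f in M]).
  exists K => // S FS; apply: card_le_trans (sub_image_card_le KM) _.
  apply: (@inj_sub_card_le _ _ (fun f => f S)) => [f g Mf Mg|f Mf].
    exact: Minj Mf Mg FS.
  exact: MS Mf FS.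
exfalso.
(* If [M] evaluates onto no member of [F], each member has a point missed by [M], and a choice [h]
   of such points would properly enlarge [M]. *)
have new S : F S -> exists2 x, S x & forall f, M f -> f S <> x.
  move=> FS; apply: contrapT => nx; apply: nK; exists S => // x Sx.
  by apply: contrapT => nMx; apply: nx; exists x => // f Mf fSx; apply: nMx; exists f.
have [x0 _ _] := new _ FS0.
have /choice[h hP] : forall S, exists x,
    F S -> S x /\ forall f, M f -> f S <> x.
  move=> S; have [/new[x Sx xM]|nFS] := pselect (F S); first by exists x.
  by exists x0 => /nFS.
apply: (Mmax (h |` M)).
  split=> [f|]; first by right.
  move=> /(_ h (or_introl erefl)) Mh.
  by have [_ /(_ _ Mh)] := hP _ FS0.
split=> [f S [->|Mf] FS|f g S [->|Mf] [->|Mg] FS //].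
- by have [] := hP _ FS.
- exact: MS Mf FS.
- by have [_ /(_ _ Mg) gh] := hP _ FS => /esym.
- by have [_ /(_ _ Mf) fh] := hP _ FS.
- exact: Minj Mf Mg FS.
Qed.

(* A maximal family G of injective sequences in S with disjoint ranges covers S
   up to a finite set, so |S * omega| <= |G * omega| <= |S|. *)
Lemma infinite_card_setX_nat (T : Type) (S : set T) :
  infinite_set S -> S `*` [set: nat] #<= S.
Proof.
elim/Ppointed: T => T in S *; first by rewrite emptyE => /(_ (finite_set0 _)).
move=> infS.
pose P (G : set (nat -> T)) :=
  (forall g i, G g -> S (g i)) /\
  (forall g h i j, G g -> G h -> g i = h j -> (g, i) = (h, j)).
have [C CP totC|G [[GS Ginj] Gmax]] := @Zorn_bigcup _ P.
  split=> [g i [M CM Mg]|g h i j [M CM Mg] [N CN Nh]].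
    by have [+ _] := CP _ CM; apply.
  have [MN|NM] := totC _ _ CM CN.
    by have [_ +] := CP _ CN; apply=> //; exact: MN.
  by have [_ +] := CP _ CM; apply=> //; exact: NM.
pose R := S `\` [set p.1 p.2 | p in G `*` [set: nat]].
have finR : finite_set R.
  apply: contrapT => /infiniteP/pcard_leP[g].
  have gR i : R (g i) by exact: (@funS _ _ _ _ g).
  have gG h i j : G h -> h j <> g i.
    by move=> Gh hg; have [_] := gR i; apply; exists (h, j).
  apply: (Gmax ((g : nat -> T) |` G)).
    split=> [f|]; first by right.
    by move=> /(_ _ (or_introl erefl)) Gg; exact: (gG g 0 0).
  split=> [h i [->|Gh]|h k i j [->|Gh] [->|Gk]].
  - by have [] := gR i.
  - exact: GS.
  - by move=> /(@inj _ _ _ g) -> //; rewrite inE.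
  - by move=> /esym /gG.
  - by move=> /gG.
  - exact: Ginj.
have [r Rr] : exists r : nat -> T, R `<=` range r.
  have /pfcard_geP[R0|[r]] : R #<= [set: nat] by exact: finite_set_countable.
    by exists (fun=> point); rewrite R0.
  by exists r => x Rx; have [i _ <-] := @surj _ _ _ _ r x Rx; exists i.
have [g0 Gg0] : G !=set0.
  have [x [Sx nRx]] := infinite_setN0 (infinite_setD infS finR).
  apply: contrapT => G0; apply: nRx; split=> // -[[g i] [Gg _] _].
  by apply: G0; exists g.
have GX : G `*` [set: nat] #<= S.
  apply: (@inj_sub_card_le _ _ (fun p => p.1 p.2)) => [[g i] [h j]|[g i]] [/= Gg _].
    by move=> [/= Gh _]; exact: Ginj.
  exact: GS.
apply: card_le_trans GX.
(* The number codes a triple [(b, k, n)]: [b] tells whether the point is term [k] of the sequence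
   [p.1] or of the sequence [r] covering [R], and [n] is the second coordinate. *)
pose phi (p : (nat -> T) * nat) : T * nat :=
  if @unpickle (bool * nat * nat)%type p.2 is Some (b, k, n)
  then (if b then p.1 k else r k, n) else (point, 0).
apply: (@sub_image_card_le _ _ phi) => -[x n] [/= Sx _].
have [[[g i] /= [Gg _] <-]|nx] := pselect ([set p.1 p.2 | p in G `*` [set: nat]] x).
  by exists (g, pickle (true, i, n)) => //; rewrite /phi /= pickleK.
have [i _ <-] := Rr _ (conj Sx nx).
by exists (g0, pickle (false, i, n)) => //; rewrite /phi /= pickleK.
Qed.

(** If [S] were finite, its product with omega would be countable, and so would [K]; hence the
    absorption for infinite sets applies. *)
Lemma uncountable_card_le_setX_nat (T U : Type) (K : set T) (S : set U) :
  ~ countable K -> K #<= S `*` [set: nat] -> K #<= S.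
Proof.
move=> ncK KS; apply: card_le_trans (KS) _.
apply: infinite_card_setX_nat => finS; apply: ncK.
apply: sub_countable KS _; apply: countableX; last exact: countableP.
exact: finite_set_countable.
Qed.

(** * Nonprincipal ultrafilters and uncountability of splitting families *)

Lemma star_infinite (A : set nat) (U : omega_star) : star A U -> infinite_set A.
Proof. by move=> AU /star_eq0 A0; move: AU; rewrite A0. Qed.

Lemma infinite_star (A : set nat) : infinite_set A -> star A !=set0.
Proof. by move=> infA; apply/set0P/eqP => /star_eq0. Qed.

(* X is a pseudo-intersection of the sets A n or their complements that belong
   to a fixed nonprincipal ultrafilter. *)
Lemma countable_unsplit (A : nat -> set nat) :
  exists2 X, infinite_set X & forall n, ~ splits Fin (A n) X.
Proof.
have [U _] := infinite_star infinite_nat.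
pose B n := if pselect (star (A n) U) then A n else ~` A n.
have BU n : star (B n) U by rewrite /B; case: pselect => // nA; rewrite starC.
(* [C n] is the intersection of [B 0] up to [B n]; it belongs to the ultrafilter, so it is
   infinite. *)
pose C := fix C n := if n is m.+1 then B m.+1 `&` C m else B 0.
have CU n : star (C n) U by elim: n => [|n IHn] //=; rewrite starI.
have CB n m : n <= m -> C m `<=` B n.
  elim: m => [|m IHm]; first by rewrite leqn0 => /eqP ->.
  rewrite leq_eqVlt => /predU1P[->|/IHm CmBn] x [] // _; exact: CmBn.
have /choice[f fP] : forall p : nat * nat, exists k, C p.1 k /\ p.2 < k.
  move=> [n m]; have infC := star_infinite (CU n).
  have [k [Ck nk]] := infinite_setN0 (infinite_setD infC (finite_II m.+1)).
  by exists k; split=> //=; rewrite ltnNge; apply/negP.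
pose x := fix x n := if n is m.+1 then f (m.+1, x m) else f (0, 0).
have xC n : C n (x n) by case: n => [|n]; [case: (fP (0, 0))|case: (fP (n.+1, x n))].
have xlt : {homo x : m n / m < n}.
  apply: homo_ltn => [???|n]; first exact: ltn_trans.
  by case: (fP (n.+1, x n)).
have xI : injective x by exact: incn_inj (leq_mono xlt).
exists (range x) => [|n].
  apply/infiniteP; apply: (@inj_sub_card_le _ _ x) => [i j _ _|i _]; first exact: xI.
  by exists i.
have finXB : finite_set (range x `\` B n).
  apply: (@sub_finite_set _ _ (x @` `I_n)) => [_ [[i _ <-] nB]|].
    exists i => //=; rewrite ltnNge; apply/negP => ni; apply: nB.
    exact: CB ni _ (xC i).
  by apply: finite_image; exact: finite_II.
(* If [A n] is in the ultrafilter, it almost contains [range x]; otherwise it almost misses it. *)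
move: finXB; rewrite /B; case: pselect => nA; first by move=> fin [_ /(_ fin)].
by rewrite setDE setCK setIC => fin [/(_ fin)].
Qed.

Lemma splitting_family_uncountable (S : set (set nat)) :
  splitting_family Fin S -> ~ countable S.
Proof.
move=> [_ Sspl] /pfcard_geP[S0|[A]].
  by have [Y] := Sspl _ infinite_nat; rewrite S0.
have [X infX AX] := countable_unsplit A.
have [_ /(@surj _ _ _ _ A)[n _ <-]] := Sspl _ infX; exact: AX.
Qed.

(** All infinite sets together work: the even-indexed terms of an injective sequence in [X] split
    [X], since the odd-indexed terms stay outside. *)
Lemma exists_splitting_family_Fin : splitting_family Fin !=set0.
Proof.
exists (~` Fin); split=> // X infX.
have /infiniteP/pcard_leP[f] := infX.
have fI : {in setT &, injective f} by exact: inj.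
have fX i : X (f i) by exact: (@funS _ _ _ _ f).
have inf2 b : infinite_set [set f (b + i.*2) | i in [set: nat]].
  apply/infiniteP; apply: (@inj_sub_card_le _ _ (fun i => f (b + i.*2))).
    move=> i j _ _ /fI; rewrite !inE => /(_ I I) /addnI.
    by rewrite -!muln2 => /eqP; rewrite eqn_pmul2r // => /eqP.
  by move=> i _; exists i.
exists [set f (0 + i.*2) | i in [set: nat]]; first exact: inf2.
split.
  apply: sub_infinite_set (inf2 0) => _ [i _ <-]; split=> //; by exists i.
apply: sub_infinite_set (inf2 1) => _ [i _ <-]; split=> // -[j _].
move=> /fI; rewrite !inE => /(_ I I) /(congr1 odd).
by rewrite !oddD !odd_double.
Qed.

Lemma least_sizeI (T U : Type) (F : set (set T)) (K : set U) :
  (exists2 S, F S & S #<= K) -> (forall S, F S -> K #<= S) -> least_size F K.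
Proof.
move=> [S FS SK] KF; split=> //; exists S => //.
by apply: Cantor_Bernstein => //; exact: KF.
Qed.

(** A finite set splits nothing, so the finite members of [H] can be discarded. *)
Lemma splitting_family_infinite (H : set (set nat)) :
  (forall X, infinite_set X -> exists2 Y, H Y & splits Fin Y X) ->
  splitting_family Fin (H `&` ~` Fin).
Proof.
move=> Hspl; split=> [Y []//|X /Hspl[Y HY YX]].
exists Y => //; split=> //; case: YX => YX _.
by apply: sub_infinite_set YX => n [].
Qed.

(** * Bounds for the free product *)

Lemma splitting_family_free_square (S : set (set nat)) :
  splitting_family Fin S ->
  algebra_splitting_family free_square [set star A `*` setT | A in S].
Proof.
move=> [Sinf Sspl]; split.
  move=> _ [A /Sinf infA <-]; split.
    apply/free_square_rectangles; exists [:: (A, setT)].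
    by rewrite set_cons1 bigcup_set1 /= starT.
  by have [u Au] := infinite_star infA; exists (u, u).
move=> b /free_square_rectangles[s ->] [[u v] [[A B] sAB [/= Au Bv]]].
have [Y SY [YA AY]] := Sspl _ (star_infinite Au).
exists (star Y `*` setT); split; first by exists Y.
  have [w] := infinite_star YA; rewrite starI => -[Yw Aw].
  by exists (w, v); split=> //; exists (A, B).
have [w] := infinite_star AY; rewrite setDE starI starC => -[Aw Yw].
by exists (w, v); split=> [|[]//]; exists (A, B).
Qed.

(** Nonprincipal ultrafilters have only infinite members, so two of them that contain [X] and
    disagree on [A] witness both halves of the splitting. *)
Lemma splits_star (A X : set nat) (u v : omega_star) :
  star X u -> star A u -> star X v -> ~ star A v -> splits Fin A X.
Proof.
move=> Xu Au Xv nAv; split; first by apply: (@star_infinite _ u); rewrite starI.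
by apply: (@star_infinite _ v); rewrite setDE starI starC.
Qed.

Lemma free_square_splitting_family (S : set (set (omega_star * omega_star))) :
  algebra_splitting_family free_square S ->
  exists2 H, splitting_family Fin H & H #<= S `*` [set: nat].
Proof.
move=> [SB Sspl].
have /choice[r rP] : forall s, exists r : seq (set nat * set nat), S s ->
    s = \bigcup_(p in [set` r]) (star p.1 `*` star p.2).
  move=> s; have [/SB[/free_square_rectangles[r sr] _]|nS] := pselect (S s).
    by exists r.
  by exists [::].
(* The parity of [p.2] selects a side of the rectangle number [p.2./2]. *)
pose f (p : set (omega_star * omega_star) * nat) : set nat :=
  let q := nth (set0, set0) (r p.1) p.2./2 in if odd p.2 then q.1 else q.2.
pose H := f @` (S `*` [set: nat]).
have HS : H `&` ~` Fin #<= S `*` [set: nat].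
  by apply: (@sub_image_card_le _ _ f) => A [].
exists (H `&` ~` Fin) => //; apply: splitting_family_infinite => X infX.
have [x Xx] := infinite_star infX.
have [||s [Ss [u [[Xu1 Xu2] su]] [v [[Xv1 Xv2] nsv]]]] := Sspl (star X `*` star X).
- apply/free_square_rectangles; exists [:: (X, X)].
  by rewrite set_cons1 bigcup_set1.
- by exists (x, x).
have := su; rewrite {1}(rP _ Ss) => -[p /= ps [pu1 pu2]].
have nth_p : nth (set0, set0) (r s) (index p (r s)) = p by exact: nth_index.
have H1 : H p.1.
  exists (s, (index p (r s)).*2.+1) => //.
  by rewrite /f /= odd_double uphalf_double nth_p.
have H2 : H p.2.
  exists (s, (index p (r s)).*2) => //.
  by rewrite /f /= odd_double doubleK nth_p.
(* The rectangle of [p] contains [u] but not [v], so one of its sides separates them. *)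
have [pv1|pv1] := pselect (star p.1 v.1).
  exists p.2 => //; apply: splits_star Xu2 pu2 Xv2 _ => pv2.
  by apply: nsv; rewrite (rP _ Ss); exists p.
by exists p.1 => //; exact: splits_star Xu1 pu1 Xv1 pv1.
Qed.

(** * Bounds for the ideal [NC] *)

Lemma centered_sub (X Y : set (set nat)) : X `<=` Y -> centered Y -> centered X.
Proof.
move=> XY [Yinf Yc]; split=> [A /XY/Yinf//|F finF F0 FX].
by apply: Yc => //; exact: subset_trans FX XY.
Qed.

Lemma xsection_setIX (A : set (nat * nat)) (Y : set nat) n :
  Y n -> xsection ((Y `*` setT) `&` A) n = xsection A n.
Proof. by move=> Yn; rewrite xsectionI in_xsectionX ?inE // setTI. Qed.

Lemma xsection_setDX (A : set (nat * nat)) (Y : set nat) n :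
  ~ Y n -> xsection (A `\` (Y `*` setT)) n = xsection A n.
Proof. by move=> Yn; rewrite xsectionD notin_xsectionX ?notin_setE // setD0. Qed.

(** All sections with index in [X] equal [Y], so [X] itself indexes a centered family. *)
Lemma not_NC_setX (X Y : set nat) :
  infinite_set X -> infinite_set Y -> ~ NC (X `*` Y).
Proof.
move=> infX infY /(_ X infX); apply.
have sY : [set xsection (X `*` Y) n | n in X] `<=` [set Y].
  by move=> _ [n Xn <-]; rewrite in_xsectionX ?inE.
apply: centered_sub sY _; split=> [_ -> //|F _ _ FY].
by apply: sub_infinite_set infY => n Yn _ /FY ->.
Qed.

(** Members of a centered family are infinite, so its index set would lie inside the given finite
    set. *)
Lemma NC_finite_sections (A : set (nat * nat)) :
  finite_set [set n | infinite_set (xsection A n)] -> NC A.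
Proof.
move=> finA X infX [XA _]; apply: infX; apply: sub_finite_set finA => n Xn.
by apply: XA; exists n.
Qed.

Lemma splitting_family_NC (S : set (set nat)) :
  splitting_family Fin S -> splitting_family NC [set A `*` setT | A in S].
Proof.
move=> [Sinf Sspl]; split=> [_ [A /Sinf infA <-]|A].
  exact: not_NC_setX infA infinite_nat.
move=> /existsNP[X /not_implyP[infX /contrapT cX]].
have [Y SY [YX XY]] := Sspl _ infX.
exists (Y `*` setT); first by exists Y.
split.
  move=> /(_ _ YX); apply; apply: centered_sub cX => _ [n [Yn Xn] <-].
  by exists n => //; rewrite xsection_setIX.
move=> /(_ _ XY); apply; apply: centered_sub cX => _ [n [Xn nYn] <-].
by exists n => //; rewrite xsection_setDX.
Qed.

Lemma NC_splitting_family (S : set (set (nat * nat))) :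
  splitting_family NC S ->
  exists2 H, splitting_family Fin H & H #<= S `*` [set: nat].
Proof.
move=> [_ Sspl].
pose sec (p : set (nat * nat) * nat) := xsection p.1 p.2.
pose H := sec @` (S `*` [set: nat]).
have [H1|] := pselect (forall X, infinite_set X -> exists2 Y, H Y & splits Fin Y X).
  exists (H `&` ~` Fin); first exact: splitting_family_infinite.
  by apply: (@sub_image_card_le _ _ sec) => A [].
move=> /existsNP[Y /not_implyP[infY nY]].
pose tr (p : set (nat * nat) * nat) := [set n | finite_set (Y `\` xsection p.1 n)].
exists (tr @` (S `*` [set: nat]) `&` ~` Fin); last first.
  by apply: (@sub_image_card_le _ _ tr) => A [].
apply: splitting_family_infinite => X infX.
have [A SA [AXY XYA]] := Sspl _ (not_NC_setX infX infY).
(* [tr] ignores the second coordinate, so [0] is a dummy. *)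
exists (tr (A, 0)); first by exists (A, 0).
(* No section splits [Y], so each one almost contains [Y] or almost misses it. *)
have secA n : ~ finite_set (Y `\` xsection A n) -> finite_set (xsection A n `&` Y).
  move=> infYA; apply: contrapT => infAY; apply: nY; exists (xsection A n) => //.
  by exists (A, n).
split=> fin.
  (* For [n] in [X] but outside [tr (A, 0)], [secA] makes the section of the intersection finite. *)
  apply: AXY; apply: NC_finite_sections; apply: sub_finite_set fin => n /= infn.
  have Xn : X n.
    by have [m /xsectionP[_ []]] := infinite_setN0 infn.
  split=> //; apply: contrapT => /secA.
  by move: infn; rewrite xsectionI in_xsectionX ?inE.
apply: XYA; apply: NC_finite_sections; apply: sub_finite_set fin => n /= infn.
have Xn : X n.
  by have [m /xsectionP[[]]] := infinite_setN0 infn.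
by split=> //=; move: infn; rewrite xsectionD in_xsectionX ?inE.
Qed.

Theorem theorem2p4 :
  exists K : set (set nat),
    [/\ least_size (splitting_family Fin) K,
        least_size (algebra_splitting_family free_square) K
      & least_size (splitting_family NC) K].
Proof.
have [K KF Kmin] := exists_card_min exists_splitting_family_Fin.
have ncK := splitting_family_uncountable KF.
have Kle (T : Type) (S : set T) :
    (exists2 H, splitting_family Fin H & H #<= S `*` [set: nat]) -> K #<= S.
  move=> [H /Kmin KH HS]; apply: uncountable_card_le_setX_nat => //.
  exact: card_le_trans KH HS.
exists K; split; apply: least_sizeI.
- by exists K.
- exact: Kmin.
- by exists [set star A `*` setT | A in K];
    [exact: splitting_family_free_square|exact: card_image_le].
- by move=> S /free_square_splitting_family/Kle.
- by exists [set A `*` setT | A in K];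
    [exact: splitting_family_NC|exact: card_image_le].
- by move=> S /NC_splitting_family/Kle.
Qed.
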